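(* $\operatorname{non}^*_\omega(\mathcal S)=\operatorname{cov}_\omega(\mathcal N)$.
   Context: $\mathcal S$ is the Solecki ideal: the ideal on the countable set $\Omega=\{U\subseteq2^\omega:U\text{ clopen of Lebesgue measure }1/2\}$ generated by the subsets $A\subseteq\Omega$ with $\bigcap A\neq\emptyset$. For an ideal $\mathscr I$ on a countable set $X$, $\operatorname{non}^*_\omega(\mathscr I)=\min\{|\mathcal A|:\mathcal A\subseteq[X]^\omega,\ \forall\overline B\in[\mathscr I]^\omega\,\exists A\in\mathcal A\,\forall B\in\overline B\ |A\cap B|<\omega\}$, where $[Y]^\omega$ is the set of countably infinite subsets of $Y$. $\mathcal N$ is the Lebesgue null ideal and $\operatorname{cov}_\omega(\mathcal N)=\min\{|\mathcal A|:\mathcal A\subseteq\mathcal N,\ \forall B\in[\mathbb R]^\omega\,\exists A\in\mathcal A\ B\subseteq A\}$. *)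

(* Defs.v *)
From HB Require Import structures.
From mathcomp Require Import all_boot all_order all_algebra.
From mathcomp Require Import all_classical all_reals all_analysis.

Set Implicit Arguments.
Unset Strict Implicit.
Unset Printing Implicit Defensive.

Import Order.TTheory GRing.Theory Num.Theory.
Import numFieldNormedType.Exports.

Local Open Scope classical_set_scope.
Local Open Scope card_scope.
Local Open Scope ring_scope.

(* [Y]^omega *)
Definition ctbl_infinite_subsets {T : Type} (Y : set T) : set (set T) :=
  [set A | A `<=` Y /\ A #= [set: nat]].

(* There is no type of cardinals: the cardinal min {|F| : F in W} is
   represented by any F in W of least cardinality. *)
Definition least_card {T : Type} (W : set (set T)) (F : set T) : Prop :=
  W F /\ forall G, W G -> F #<= G.

Record is_ideal {T : Type} (X : set T) (I : set (set T)) : Prop := IsIdeal {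
  ideal_sub : forall A, I A -> A `<=` X ;
  ideal0 : I set0 ;
  idealS : forall A B, A `<=` B -> I B -> I A ;
  idealU : forall A B, I A -> I B -> I (A `|` B) }.

(* non*_omega(I) is the least cardinality of an element of this class. *)
Definition non_star_omega_families {T : Type} (X : set T) (I : set (set T)) :
    set (set (set T)) :=
  [set F | F `<=` ctbl_infinite_subsets X /\
    forall Bs, ctbl_infinite_subsets I Bs ->
      exists2 A, F A & forall B, Bs B -> finite_set (A `&` B)].

Definition null_ideal (R : realType) : set (set R) :=
  [set A | (@lebesgue_measure R).-negligible A].
Arguments null_ideal R _ : clear implicits.

(* cov_omega(I) is the least cardinality of an element of this class. *)
Definition cov_omega_families {T : Type} (I : set (set T)) :
    set (set (set T)) :=
  [set F | F `<=` I /\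
    forall B, ctbl_infinite_subsets [set: T] B -> exists2 A, F A & B `<=` A].

(** Lebesgue measure on the Cantor space, as the law of the binary digits of a
    uniformly distributed point of [0, 1[; see [cantor_measure_cylinder]. *)

Definition binary_digits {R : realType} (x : R) : cantor_space :=
  fun n => odd (Num.truncn (x * 2 ^+ n.+1)).

Definition cylinder (n : nat) (s : nat -> bool) : set cantor_space :=
  [set x | forall i, (i < n)%N -> x i = s i].

(* The Cantor space with its Borel sigma-algebra. *)
Definition cantor_borel := g_sigma_algebraType (@open cantor_space).

Section cantor_measure.
Context {R : realType}.

Let digits : R -> cantor_borel := binary_digits.

Let prefix_val (s : nat -> bool) (n : nat) : nat :=
  iteri n (fun i k => s i + k.*2)%N 0%N.

Let prefix_val_lt s n : (prefix_val s n < 2 ^ n)%N.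
Proof.
elim: n => //= n IHn; rewrite expnS mul2n.
by case: (s n); rewrite ?add0n ?ltn_double//= add1n -doubleS leq_double.
Qed.

Let truncn_half (x : R) : 0 <= x -> (Num.truncn (x * 2))./2 = Num.truncn x.
Proof.
move=> x0; apply/esym/truncn_def.
have := truncn_itv (mulr_ge0 x0 (ler0n R 2)).
move: (Num.truncn _) => m; have me : m = (odd m + m./2.*2)%N.
  by rewrite odd_double_half.
move=> /andP[l r]; apply/andP; split.
  rewrite -(ler_pM2r (ltr0n R 2)) (le_trans _ l)// -natrM ler_nat muln2.
  by rewrite {2}me leq_addl.
rewrite -(ltr_pM2r (ltr0n R 2)) (lt_le_trans r)// -natrM ler_nat muln2 doubleS.
by rewrite {1}me; case: (odd m).
Qed.

Let digits_cylinderP s n (x : R) : 0 <= x < 1 ->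
  cylinder n s (digits x) <-> Num.truncn (x * 2 ^+ n) = prefix_val s n.
Proof.
move=> /andP[x0 x1]; elim: n => [|n IHn].
  by rewrite expr0 mulr1 /=; split => // _; apply: truncn_def; rewrite x0.
have h : (Num.truncn (x * 2 ^+ n.+1))./2 = Num.truncn (x * 2 ^+ n).
  by rewrite exprSr mulrA truncn_half// mulr_ge0// exprn_ge0.
split=> [c|e].
  rewrite -(odd_double_half (Num.truncn _)) h /=.
  have -> : odd (Num.truncn (x * 2 ^+ n.+1)) = s n by exact: (c n).
  by rewrite (IHn.1 _)// => i /ltnW; exact: c.
have := h; rewrite e /= half_bit_double => /esym/IHn c i.
rewrite ltnS leq_eqVlt => /predU1P[->|]; last exact: c.
by rewrite /digits /binary_digits e /= oddD odd_double addbF oddb.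
Qed.

Let digits_cylinder s n :
  digits @^-1` cylinder n s `&` `[0, 1[%classic =
  `[(prefix_val s n)%:R / 2 ^+ n, (prefix_val s n).+1%:R / 2 ^+ n[%classic.
Proof.
have p2 : 0 < 2 ^+ n :> R by rewrite exprn_gt0.
apply/seteqP; split => x /=; rewrite !in_itv/=.
  move=> [c x01]; move/digits_cylinderP: (x01) => /(_ s n)/iffLR/(_ c) e.
  have /andP[x0 _] := x01.
  by rewrite ler_pdivrMr// ltr_pdivlMr// -e truncn_itv// mulr_ge0// ltW.
rewrite ler_pdivrMr// ltr_pdivlMr// => xs.
have x01 : 0 <= x < 1.
  case/andP: xs => l r; rewrite -(pmulr_lge0 _ p2) (le_trans _ l)//=.
  rewrite -(ltr_pM2r p2) mul1r (lt_le_trans r)// -natrX ler_nat.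
  exact: prefix_val_lt.
by split => //; apply/digits_cylinderP => //; exact: truncn_def.
Qed.

Let digit_measurable i b : measurable [set x : R | digits x i = b].
Proof.
have mono (m : nat) :
    measurable [set x : R | Num.truncn (x * 2 ^+ i.+1) = m].
  have p2 : 0 < 2 ^+ i.+1 :> R by rewrite exprn_gt0.
  have -> : [set x : R | Num.truncn (x * 2 ^+ i.+1) = m] =
      `]-oo, m.+1%:R / 2 ^+ i.+1[ `\`
      (if m is 0%N then set0 else `]-oo, m%:R / 2 ^+ i.+1[).
    apply/seteqP; split => x /=; rewrite in_itv/= ltr_pdivlMr//.
      move=> <-; split; first exact: truncnS_gt.
      case e: (Num.truncn _) => [|k]//=; rewrite in_itv/= ltr_pdivlMr//.
      by apply/negP; rewrite -leNgt -truncn_gt_nat e.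
    move=> [r]; case: m r => [|m] r.
      by move=> _; apply/eqP; rewrite -leqn0 truncn_le_nat.
    rewrite /= in_itv/= ltr_pdivlMr// => /negP; rewrite -leNgt => l.
    by apply: truncn_def; rewrite l.
  by apply: measurableD => //; case: m.
rewrite (_ : [set _ | _] = \bigcup_(m in [set m | odd m = b])
    [set x : R | Num.truncn (x * 2 ^+ i.+1) = m]); last first.
  by apply/seteqP; split => [x <-|x [m <-] <-]//; exists (Num.truncn (x * 2 ^+ i.+1)).
exact: bigcup_measurable.
Qed.

Let open_cylinder (U : set cantor_space) (x : cantor_space) : open U -> U x ->
  exists n, cylinder n x `<=` U.
Proof.
move=> oU Ux; apply: contrapT => /forallNP nU.
have /choice[y yP] : forall n, exists y, cylinder n x y /\ ~ U y.
  move=> n; apply: contrapT => /forallNP h; apply: (nU n) => y cy.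
  by apply: contrapT => Uy; apply: (h y).
have : (y : nat -> cantor_space) @ \oo --> x.
  apply/cvg_sup => i V [W] [[X] oX <-] Xx WV.
  apply: (filterS WV); exists i.+1 => // n /= ni.
  by move: Xx; rewrite /= ((yP n).1 i).
move=> /(_ U (open_nbhs_nbhs (conj oU Ux)))[N _ /(_ N (leqnn N))].
exact: (yP N).2.
Qed.

Let digits_measurable : measurable_fun [set: R] digits.
Proof.
apply: (@measurability _ _ R cantor_borel setT digits (@open cantor_space) erefl).
move=> _ [U oU <-].
have mcyl (p : seq bool) :
    measurable (digits @^-1` cylinder (size p) (nth false p)).
  rewrite (_ : _ @^-1` _ = \bigcap_(i in `I_(size p))
      [set x : R | digits x i = nth false p i]); last first.
    by apply/seteqP; split.
  by apply: bigcap_measurableType.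
rewrite setTI (_ : digits @^-1` U =
  \bigcup_(p in [set p | cylinder (size p) (nth false p) `<=` U])
     digits @^-1` cylinder (size p) (nth false p)); last first.
  apply/seteqP; split => [x /= Ux|x [p /= pU xp]]; last exact: pU.
  have [n nU] := open_cylinder oU Ux.
  have e i : (i < n)%N -> nth false (mkseq (digits x) n) i = digits x i.
    exact: nth_mkseq.
  exists (mkseq (digits x) n); rewrite /= size_mkseq.
    by move=> y yx; apply: nU => i ni; rewrite yx// e.
  by move=> i ni; rewrite e.
rewrite bigcup_mkcond; apply: countable_bigcupT_measurable => // p.
by case: ifP.
Qed.

Definition cantor_measure : set cantor_borel -> \bar R :=
  pushforward (mrestr lebesgue_measure (@measurable_itv R `[0, 1[)) digits.

Let cantor_measure0 : cantor_measure set0 = 0%E.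
Proof. by rewrite /cantor_measure /pushforward preimage_set0 measure0. Qed.

Let cantor_measure_ge0 A : (0 <= cantor_measure A)%E.
Proof. exact: measure_ge0. Qed.

Let cantor_measure_sigma_additive : semi_sigma_additive cantor_measure.
Proof.
move=> F mF tF mUF; rewrite /cantor_measure /pushforward preimage_bigcup.
apply: measure_semi_sigma_additive.
- by move=> n; rewrite -[X in measurable X]setTI; exact: digits_measurable.
- apply/trivIsetP => /= i j _ _ ij; rewrite -preimage_setI.
  by move/trivIsetP : tF => /(_ _ _ _ _ ij) ->//; rewrite preimage_set0.
- rewrite -preimage_bigcup -[X in measurable X]setTI.
  exact: digits_measurable.
Qed.

HB.instance Definition _ := isMeasure.Build _ _ _ cantor_measure
  cantor_measure0 cantor_measure_ge0 cantor_measure_sigma_additive.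

Lemma cantor_measure_cylinder (n : nat) (s : nat -> bool) :
  cantor_measure (cylinder n s) = (2 ^- n)%:E.
Proof.
rewrite /cantor_measure /pushforward /mrestr digits_cylinder.
rewrite lebesgue_measure_itv/= lte_fin ltr_pM2r ?invr_gt0 ?exprn_gt0//.
by rewrite ltr_nat ltnSn -EFinB -mulrBl -natrB// subSnn mul1r.
Qed.

Let cantor_measure_setT : cantor_measure [set: _] = 1%E.
Proof.
rewrite (_ : [set: _] = cylinder 0 xpredT); last by apply/seteqP; split.
by rewrite cantor_measure_cylinder expr0 invr1.
Qed.

HB.instance Definition _ := Measure_isProbability.Build _ _ _ cantor_measure
  cantor_measure_setT.

End cantor_measure.

(* The countable set the Solecki ideal lives on. *)
Definition half_clopens (R : realType) : set (set cantor_space) :=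
  [set U | clopen U /\ @cantor_measure R U = (2^-1)%:E].

Definition solecki_ideal (R : realType) : set (set (set cantor_space)) :=
  smallest (is_ideal (half_clopens R))
    [set A | A `<=` half_clopens R /\ \bigcap_(U in A) U !=set0].

(* Main.v *)
Require Import Defs.
From mathcomp Require Import all_boot all_order all_algebra.
From mathcomp Require Import all_classical all_reals all_analysis.
From mathcomp Require Import measurable_realfun zify lra.

Set Implicit Arguments.
Unset Strict Implicit.
Unset Printing Implicit Defensive.

Import Order.TTheory GRing.Theory Num.Theory.
Import numFieldNormedType.Exports.

Local Open Scope classical_set_scope.
Local Open Scope card_scope.
Local Open Scope ring_scope.

(* Up to finite unions, a member of the Solecki ideal is a set of half-measure
   clopens containing a given point, so a countable subfamily of the ideal
   amounts to a countable set of points x, and a sequence (U_n) is almost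
   disjoint from all its members iff each x lies in finitely many U_n only.

   A null set N of reals has an open superset W of measure < 1/4.  The union D_n
   of the level-n cylinders inside W has measure < 1/4, so some half-measure U_n
   misses D_n, and every point of N lies in finitely many U_n only.

   Conversely, given half-measure clopens U_n, let T be the set of reals all of
   whose rational translates lie in finitely many U_n only.  T is invariant under
   rational translations, so it meets the complement of each U_n in half of its
   measure; as T is the increasing union of the sets of points of T avoiding all
   U_n with n >= m, its measure is at most half of itself, hence zero. *)

(* Take a maximal set of choice functions on W that is injective in every
   coordinate: it must exhaust some coordinate F, and then F injects into every
   member of W. *)
Lemma ex_least_card {T : Type} (W : set (set T)) :
  W !=set0 -> exists F, least_card W F.
Proof.
move=> W0.
pose P := [set p : set (set T -> T) |
  (forall f G, p f -> W G -> G (f G)) /\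
  forall f g G, p f -> p g -> W G -> f G = g G -> f = g].
have [p [[pW pI] pmax]] : exists p, P p /\ forall q, p `<` q -> ~ P q.
  apply: Zorn_bigcup => C CP Ctot; split.
    by move=> f G [p Cp pf]; exact: (CP _ Cp).1.
  move=> f g G [p Cp pf] [q Cq qg]; have [pq|qp] := Ctot _ _ Cp Cq.
    exact: (CP _ Cq).2 (pq _ pf) qg.
  exact: (CP _ Cp).2 pf (qp _ qg).
have [F WF FE] : exists2 F, W F & forall y, F y -> exists2 f, p f & f F = y.
  (* Otherwise some [h] picks in each [G] of [W] a value that no function of [p] takes at [G], and
     adding [h] to [p] contradicts maximality. *)
  apply: contrapT => /forall2NP noF.
  have /choice[h hP] : forall G, exists y, W G -> G y /\ forall f, p f -> f G <> y.
    move=> G; have [WG|nWG] := pselect (W G); last first.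
      by have [G0 WG0] := W0; case: (noF G0) => // /existsNP[y _]; exists y.
    have [//|] := noF G.
    move=> /existsNP[y /not_implyP[Gy /forall2NP np]]; exists y => _; split => //.
    by move=> f pf; have [|] := np f.
  apply: (pmax (p `|` [set h])).
    split; first exact: subsetUl.
    move=> /(_ h (or_intror erefl)) ph; have [G WG] := W0.
    exact: (hP G WG).2 _ ph erefl.
  split=> [f G [pf|->]|f g G [pf|->] [pg|->]] WG.
  - exact: pW pf WG.
  - exact: (hP G WG).1.
  - exact: pI pf pg WG.
  - by move/((hP G WG).2 _ pf).
  - by move/esym/((hP G WG).2 _ pg).
  - by [].
exists F; split => // G WG.
have /choice[k kP] : forall y, exists f, F y -> p f /\ f F = y.
  move=> y; have [Fy|nFy] := pselect (F y); last by exists (fun=> y).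
  by have [f pf fy] := FE _ Fy; exists f.
suff [f] : $|{injfun F >-> G}| by exact: inj_card_le f.
apply/injfunPex; exists (fun y => k y G).
  by move=> y Fy; exact: pW (kP y Fy).1 WG.
move=> y z /set_mem Fy /set_mem Fz e.
have [[pky <-] [pkz <-]] := (kP y Fy, kP z Fz).
by congr (_ F); exact: pI pky pkz WG e.
Qed.

(** * Clopen subsets of the Cantor space *)

(** The digit of index 0 is the most significant, so the cylinders of a level are numbered like the
    dyadic intervals, from left to right. *)
Fixpoint prefix (x : cantor_space) (n : nat) : nat :=
  if n is m.+1 then (x m + (prefix x m).*2)%N else 0%N.

Lemma prefix_lt x n : (prefix x n < 2 ^ n)%N.
Proof.
elim: n => //= n IHn; rewrite expnS mul2n.
by case: (x n); rewrite ?add0n ?ltn_double// add1n -doubleS leq_double.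
Qed.

Lemma prefix_half x n : (prefix x n.+1)./2 = prefix x n.
Proof. exact: half_bit_double. Qed.

Lemma prefix_odd x n : odd (prefix x n.+1) = x n.
Proof. by rewrite /= oddD odd_double addbF oddb. Qed.

Lemma prefix_eqP x y n : prefix x n = prefix y n <-> cylinder n y x.
Proof.
elim: n => [|n IHn]; first by split.
split=> [e|c].
  have xyn : x n = y n by rewrite -(prefix_odd x) e prefix_odd.
  have /IHn c : prefix x n = prefix y n by rewrite -(prefix_half x) e prefix_half.
  by move=> i; rewrite ltnS leq_eqVlt => /predU1P[->//|/c].
by rewrite /= (c n)//; congr (_ + _.*2)%N; apply/IHn => i /ltnW; exact: c.
Qed.

Definition prefix_ord (x : cantor_space) n : 'I_(2 ^ n) := Ordinal (prefix_lt x n).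

Definition level n (S : {set 'I_(2 ^ n)}) : set cantor_space :=
  [set x | prefix_ord x n \in S].

Lemma levelC n (S : {set 'I_(2 ^ n)}) : ~` level S = level (~: S).
Proof. by apply/seteqP; split => x /=; rewrite /level/= inE => /negP. Qed.

Lemma open_cylinder n x : open (cylinder n x).
Proof.
elim: n => [|n IHn].
  by rewrite (_ : cylinder 0 x = setT); [exact: openT|exact/seteqP].
rewrite (_ : cylinder n.+1 x = cylinder n x `&` (@^~ n) @^-1` [set x n]).
  apply: openI => //.
  apply: (@open_comp _ _ (fun y : cantor_space => y n)).
    by move=> y _; exact: (@proj_continuous _ (fun=> bool) n y).
  exact: discrete_open.
apply/seteqP; split => [y c|y [c yx] i]; first by split=> [i /ltnW|]; exact: c.
by rewrite ltnS leq_eqVlt => /predU1P[->//|/c].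
Qed.

(** Otherwise points outside [U] agreeing with [x] on ever more digits converge to [x], as
    convergence is coordinatewise. *)
Lemma cylinder_sub_open (U : set cantor_space) x : open U -> U x ->
  exists n, cylinder n x `<=` U.
Proof.
move=> oU Ux; apply: contrapT => /forallNP nU.
have /choice[y yP] : forall n, exists y, cylinder n x y /\ ~ U y.
  move=> n; apply: contrapT => /forallNP h; apply: (nU n) => z cz.
  by apply: contrapT => Uz; exact: (h z).
suff : y @ \oo --> x.
  move=> /(_ U (open_nbhs_nbhs (conj oU Ux)))[N _ /(_ N (leqnn N))].
  exact: (yP N).2.
apply/cvg_sup => i V [W [[X oX <-] Xx WV]].
apply: (filterS WV); exists i.+1 => // n /= ni.
by move: Xx; rewrite /= ((yP n).1 i).
Qed.

Lemma open_level n (S : {set 'I_(2 ^ n)}) : open (level S).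
Proof.
rewrite (_ : level S = \bigcup_(x in level S) cylinder n x).
  by apply: bigcup_open => x _; exact: open_cylinder.
apply/seteqP; split => [x Sx|x [y Sy /prefix_eqP xy]]; first by exists x.
by rewrite /level/= (_ : prefix_ord x n = prefix_ord y n)//; exact: val_inj.
Qed.

Lemma clopen_level n (S : {set 'I_(2 ^ n)}) : clopen (level S).
Proof.
split; first exact: open_level.
by rewrite -openC levelC; exact: open_level.
Qed.

(** Membership in [U] is constant on a cylinder around each point, and compactness gives one level
    that works for all points. *)
Lemma clopenP (U : set cantor_space) : clopen U ->
  exists n (S : {set 'I_(2 ^ n)}), U = level S.
Proof.
move=> [oU cU].
have [N _ /(_ N (leqnn N)) NP] : \forall n \near \oo,
    [set: cantor_space] `<=` [set x | forall y, cylinder n x y -> (U x <-> U y)].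
  have /compact_near_coveringP := cantor_space_compact.
  apply => x _.
  have [m mP] : exists m, forall y, cylinder m x y -> (U x <-> U y).
    have [Ux|nUx] := pselect (U x).
      by have [m mU] := cylinder_sub_open oU Ux; exists m => y /mU.
    have [m mU] := cylinder_sub_open (closed_openC cU) nUx.
    by exists m => y /mU.
  exists (cylinder m x, [set n | (m <= n)%N]).
    split; last by exists m.
    by apply: open_nbhs_nbhs; split; [exact: open_cylinder|].
  move=> [x' n] /= [cx' mn] y cy.
  rewrite -(mP x')// -(mP y)// => i im.
  by rewrite cy ?cx'// (leq_trans im).
exists N, [set k : 'I_(2 ^ N) | `[< exists2 x, prefix_ord x N = k & U x >]]%SET.
apply/seteqP; split => x; rewrite /level/= inE.
  by move=> Ux; apply/asboolP; exists x.
move=> /asboolP[y /(congr1 val)/= /prefix_eqP xy Uy].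
exact/(NP x I y xy).
Qed.

(** * Binary expansions of reals and dyadic intervals *)

Lemma truncn_half {R : realType} (x : R) : 0 <= x ->
  (Num.truncn (x * 2))./2 = Num.truncn x.
Proof.
move=> x0; apply/esym/truncn_def.
have /truncn_itv : 0 <= x * 2 by rewrite mulr_ge0.
rewrite -natr1 -{1 2}(odd_double_half (Num.truncn (x * 2))) natrD -muln2 natrM.
rewrite -[_.+1%:R]natr1.
by case: odd => /=; rewrite ?mulr0n ?mulr1n => /andP[? ?]; apply/andP; split; lra.
Qed.

Lemma prefix_digits {R : realType} (t : R) n : 0 <= t < 1 ->
  prefix (binary_digits t) n = Num.truncn (t * 2 ^+ n).
Proof.
move=> /andP[t0 t1]; elim: n => [|n IHn].
  by rewrite mulr1; apply/esym/truncn_def; rewrite t0.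
rewrite /= IHn -[RHS]odd_double_half; congr (_ + _.*2)%N.
by rewrite exprSr mulrA truncn_half// mulr_ge0// exprn_ge0.
Qed.

Definition dyadic_itv {R : realType} n (k : nat) : set R :=
  `[k%:R / 2 ^+ n, k.+1%:R / 2 ^+ n[.

Lemma dyadic_itvP {R : realType} (t : R) n k : 0 <= t < 1 ->
  dyadic_itv n k t <-> prefix (binary_digits t) n = k.
Proof.
move=> t01; rewrite prefix_digits// /dyadic_itv/= in_itv/=.
have p2 : 0 < 2 ^+ n :> R by rewrite exprn_gt0.
have t0 : 0 <= t * 2 ^+ n by case/andP: t01 => ? _; rewrite mulr_ge0// ltW.
rewrite ler_pdivrMr// ltr_pdivlMr//; split; first exact: truncn_def.
by move=> <-; exact: truncn_itv.
Qed.

Lemma dyadic_itv01 {R : realType} n k (t : R) : (k < 2 ^ n)%N ->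
  dyadic_itv n k t -> 0 <= t < 1.
Proof.
have p2 : 0 < 2 ^+ n :> R by rewrite exprn_gt0.
rewrite /dyadic_itv/= in_itv/= => kn /andP[l r].
rewrite (le_trans _ l) ?divr_ge0 ?(ltW p2)//= (lt_le_trans r)//.
by rewrite ler_pdivrMr// mul1r -natrX ler_nat.
Qed.

Lemma digits_level {R : realType} n (S : {set 'I_(2 ^ n)}) :
  binary_digits @^-1` level S `&` `[0, 1[ =
  \bigcup_(k in [set` S]) (dyadic_itv n k : set R).
Proof.
apply/seteqP; split => [t [/= St]|t [k /= kS tk]].
  rewrite in_itv/= => t01; exists (prefix_ord (binary_digits t) n) => //.
  exact/dyadic_itvP.
have t01 := dyadic_itv01 (ltn_ord k) tk; rewrite in_itv/=; split => //.
have /(dyadic_itvP _ _ t01) e := tk.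
by rewrite /level/= (_ : prefix_ord _ n = k)//; exact: val_inj.
Qed.

(* [r] is the number with binary expansion [x], which may end in ones. *)
Definition binary_value {R : realType} (x : cantor_space) (r : R) :=
  forall n, (prefix x n)%:R / 2 ^+ n <= r <= (prefix x n).+1%:R / 2 ^+ n.

Lemma binary_value_digits {R : realType} (t : R) : 0 <= t < 1 ->
  binary_value (binary_digits t) t.
Proof.
move=> t01 n.
have /(dyadic_itvP _ _ t01) := erefl (prefix (binary_digits t) n).
by rewrite /dyadic_itv/= in_itv/= => /andP[-> /ltW].
Qed.

(** The left endpoints increase, the right ones decrease, and the supremum of the former lies
    between them all. *)
Lemma ex_binary_value {R : realType} x : exists r : R, binary_value x r.
Proof.
have p2 n : 0 < 2 ^+ n :> R by rewrite exprn_gt0.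
pose a n : R := (prefix x n)%:R / 2 ^+ n.
pose b n : R := (prefix x n).+1%:R / 2 ^+ n.
have a_nd : nondecreasing_seq a.
  apply/nondecreasing_seqP => n; rewrite /a ler_pdivrMr// exprS invfM mulrA.
  rewrite divfK ?gt_eqF// ler_pdivlMr// -natrM ler_nat /=.
  by rewrite muln2 leq_addl.
have b_ni : nonincreasing_seq b.
  apply/nonincreasing_seqP => n; rewrite /b ler_pdivrMr// exprS mulrCA.
  rewrite divfK ?gt_eqF// mulrC -natrM ler_nat /= muln2 doubleS.
  by case: (x n); rewrite ?add0n// ltnW.
have ab n m : a n <= b m.
  rewrite (le_trans (a_nd _ _ (leq_maxl n m)))//.
  rewrite (le_trans _ (b_ni _ _ (leq_maxr n m)))//.
  by rewrite /a /b ler_pM2r ?invr_gt0// ler_nat.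
have a_sup : has_sup (range a).
  by split; [exists (a 0), 0%N|exists (b 0) => _ [n _ <-]].
exists (sup (range a)) => n; apply/andP; split.
  by apply: ub_le_sup; [exact: a_sup.2|exists n].
by apply: ge_sup; [exact: a_sup.1|move=> _ [m _ <-]; exact: ab].
Qed.

(** * Translations and the measure of clopens *)

Lemma measurable_shift {R : realType} (d : R) (A : set R) :
  measurable A -> measurable ((fun x => x + d) @^-1` A).
Proof.
move=> mA; rewrite -[X in measurable X]setTI.
apply: (continuous_measurable_fun (f := fun x : R => x + d)) => //.
by move=> x; apply: continuousD; [exact: cvg_id|exact: cvg_cst].
Qed.

Lemma lebesgue_measure_shift {R : realType} (d : R) (A : set R) :
  measurable A -> lebesgue_measure ((fun x => x + d) @^-1` A) = lebesgue_measure A.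
Proof.
move=> mA.
suff : pushforward lebesgue_measure
    ((fun x => x + d) : _ -> measurableTypeR R) A = lebesgue_measure A by [].
apply/esym/lebesgue_measure_unique => //=.
  by move=> _ B mB; rewrite setTI; exact: measurable_shift.
move=> mf _ [[a b] _ <-]; rewrite /pushforward.
rewrite (_ : _ @^-1` _ = `]a - d, b - d]%classic).
  rewrite !lebesgue_measure_itv/= !lte_fin ltrD2r -!EFinD.
  by case: ifP; rewrite // opprB addrA subrK.
by apply/seteqP; split => x /=; rewrite !in_itv/= ltrBlDr lerBrDr.
Qed.

Lemma measurable_dyadic_itv {R : realType} n k :
  measurable (dyadic_itv n k : set R).
Proof. exact: measurable_itv. Qed.

(* Invariance under rational translations makes the level-[n] dyadic
   intervals contribute equally. *)
Lemma measure_level {R : realType} (T : set R) n (S : {set 'I_(2 ^ n)}) :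
  measurable T -> (forall q : rat, (fun x => x + ratr q) @^-1` T = T) ->
  (lebesgue_measure (T `&` (binary_digits @^-1` level S `&` `[0%R, 1%R[)) =
  (#|S|%:R)%:E * lebesgue_measure (T `&` dyadic_itv n 0))%E.
Proof.
move=> mT Tq.
rewrite digits_level setI_bigcupr bigcup_pred measure_bigsetU_ord_cond.
- rewrite mule_natl -[RHS]sumr_const; apply: eq_bigr => k _.
  (* Translating by the rational [k / 2 ^ n] carries the interval of index 0 to that of index [k]
     and preserves [T]. *)
  rewrite -[LHS](lebesgue_measure_shift (ratr (k%:R / 2 ^+ n))).
    rewrite preimage_setI Tq; congr (lebesgue_measure (_ `&` _)).
    rewrite /dyadic_itv; apply/seteqP; split => x /=.
      rewrite !in_itv/= fmorph_div rmorphXn/= !ratr_nat.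
      by rewrite -[k.+1%:R]nat1r mulrDl mul0r lerDr ltrD2r.
    rewrite !in_itv/= fmorph_div rmorphXn/= !ratr_nat.
    by rewrite -[k.+1%:R]nat1r mulrDl mul0r lerDr ltrD2r.
  by apply: measurableI => //; exact: measurable_dyadic_itv.
- by move=> k _; apply: measurableI => //; exact: measurable_dyadic_itv.
apply/trivIsetP => i j _ _ ij; apply/eqP/negPn/negP.
move=> /set0P[t [[_ ti] [_ tj]]]; move/eqP : ij; apply; apply: val_inj => /=.
have t01 := dyadic_itv01 (ltn_ord i) ti.
by rewrite -((dyadic_itvP n i t01).1 ti) -((dyadic_itvP n j t01).1 tj).
Qed.

Lemma card_setC_pow n (S : {set 'I_(2 ^ n)}) : (#|~: S| = 2 ^ n - #|S|)%N.
Proof. by rewrite -[X in (X - _)%N]card_ord -(cardsC S) addKn. Qed.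

(** This is [measure_level] with the whole line as invariant set. *)
Lemma cantor_measure_level {R : realType} n (S : {set 'I_(2 ^ n)}) :
  @cantor_measure R (level S) = (#|S|%:R / 2 ^+ n)%:E.
Proof.
rewrite /cantor_measure /pushforward /mrestr -[X in lebesgue_measure X]setTI.
rewrite measure_level//.
rewrite setTI /dyadic_itv lebesgue_measure_itv/= lte_fin.
by rewrite ltr_pM2r ?invr_gt0 ?exprn_gt0// ltr01 -EFinB mul0r subr0 mul1r.
Qed.

Lemma half_clopens_level {R : realType} n (S : {set 'I_(2 ^ n)}) :
  half_clopens R (level S) <-> (#|S|.*2 = 2 ^ n)%N.
Proof.
have p2 : (2 ^+ n : R) != 0 by rewrite gt_eqF// exprn_gt0.
rewrite /half_clopens/= cantor_measure_level -[2^-1]mul1r; split=> [[_ [/eqP]]|e].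
  rewrite eqr_div ?pnatr_eq0// mul1r -natrX -natrM eqr_nat muln2 => /eqP ->.
  by [].
split; first exact: clopen_level.
by congr EFin; apply/eqP; rewrite eqr_div ?pnatr_eq0// mul1r -natrM muln2 e natrX.
Qed.

(** * Reals whose rational translates avoid half-measure clopens *)

Definition eventually_avoids (u : nat -> set cantor_space) (x : cantor_space) :=
  exists m, forall n, (m <= n)%N -> ~ u n x.

(* Ranging over all rational translates makes the set invariant. *)
Definition avoiding_reals {R : realType} (u : nat -> set cantor_space) : set R :=
  [set t | forall q : rat, 0 <= t + ratr q < 1 ->
     eventually_avoids u (binary_digits (t + ratr q))].

Lemma avoiding_reals_shift {R : realType} u (q : rat) :
  (fun x => x + ratr q) @^-1` (@avoiding_reals R u) = avoiding_reals u.
Proof.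
apply/seteqP; split => t /= tu p; last first.
  by rewrite -addrA -rmorphD; exact: tu.
by rewrite -[p](subrK q) [_ + q]addrC rmorphD addrA; exact: tu.
Qed.

Lemma measurable_digits_clopen {R : realType} (U : set cantor_space) :
  clopen U -> measurable (binary_digits @^-1` U `&` `[0, 1[ : set R).
Proof.
move=> /clopenP[n [S ->]]; rewrite digits_level.
by apply: fin_bigcup_measurable => // k _; exact: measurable_dyadic_itv.
Qed.

Lemma measurable_avoiding_reals {R : realType} u :
  (forall n, clopen (u n)) -> measurable (@avoiding_reals R u).
Proof.
move=> cu; pose I01 : set R := `[0, 1[%classic.
(* [E] gathers the points of [[0, 1[] whose digits lie in no [u n] from some index on. The
   complement of [[0, 1[] joins it below because translates outside [[0, 1[] are unconstrained. *)
pose E := \bigcup_m \bigcap_(n in [set n | (m <= n)%N])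
  (I01 `\` (binary_digits @^-1` u n `&` I01)).
have mE : measurable (~` I01 `|` E).
  apply: measurableU; first by apply: measurableC; exact: measurable_itv.
  apply: bigcupT_measurable => m; apply: bigcap_measurableType => n _.
  apply: measurableD; first exact: measurable_itv.
  exact: measurable_digits_clopen.
rewrite (_ : avoiding_reals u =
    ~` \bigcup_q ~` ((fun x => x + ratr q) @^-1` (~` I01 `|` E))).
  apply: measurableC; apply: bigcupT_measurable_rat => q.
  by apply: measurableC; exact: measurable_shift.
rewrite setC_bigcup; apply/seteqP; split => t /= tu q.
  move=> _; rewrite setCK/=; have [tq|] := pselect (I01 (t + ratr q)); last by left.
  right; have [m mP] : eventually_avoids u (binary_digits (t + ratr q)).
    by apply: tu; move: tq; rewrite /I01/= in_itv.
  by exists m => // n /= mn; split => // -[+ _]; exact: mP.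
move=> tq; have : I01 (t + ratr q) by rewrite /I01/= in_itv.
move: (tu q I); rewrite setCK => -[//|[m _ mP] _].
by exists m => n mn utn; have [tI] := mP _ mn; apply.
Qed.

(** At a level describing [U], half of the dyadic intervals avoid [U], and [T] has the same measure
    in each interval. *)
Lemma measure_avoid_half {R : realType} (T : set R) (U : set cantor_space) :
  measurable T -> (forall q : rat, (fun x => x + ratr q) @^-1` T = T) ->
  half_clopens R U ->
  (2%:E * lebesgue_measure (T `&` (binary_digits @^-1` (~` U) `&` `[0%R, 1%R[)) =
   lebesgue_measure (T `&` `[0%R, 1%R[))%E.
Proof.
move=> mT Tq hU; have [n [S US]] := clopenP hU.1.
move: hU; rewrite US => /half_clopens_level cS.
have cSC : (2 * #|~: S| = 2 ^ n)%N by rewrite card_setC_pow mul2n; lia.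
rewrite levelC measure_level// muleA -EFinM -natrM cSC.
rewrite (_ : `[0%R, 1%R[%classic =
    binary_digits @^-1` (level [set: 'I_(2 ^ n)]) `&` `[0%R, 1%R[ :> set R).
  by rewrite measure_level// cardsT card_ord.
by apply/seteqP; split => // t []; split => //=; rewrite /level/= inE.
Qed.

Lemma null_avoiding_reals {R : realType} u :
  (forall n, half_clopens R (u n)) -> null_ideal R (avoiding_reals u).
Proof.
move=> hu; have mT := measurable_avoiding_reals (R := R) (fun n => (hu n).1).
have Tq := avoiding_reals_shift (R := R) u.
set T : set R := avoiding_reals u.
pose mu := @lebesgue_measure R.
have mI : measurable (`[0, 1[ : set R) by exact: measurable_itv.
have muI : mu `[0, 1[%classic = 1%E.
  by rewrite /mu lebesgue_measure_itv/= lte_fin ltr01 -EFinB subr0.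
(* Finiteness is what lets a measure at most half of itself be zero. *)
have muT_fin : mu (T `&` `[0, 1[) \is a fin_num.
  rewrite ge0_fin_numE ?measure_ge0//.
  rewrite (@le_lt_trans _ _ (mu `[0, 1[%classic))//; last by rewrite muI ltry.
  by apply: le_measure; rewrite ?inE//; exact: measurableI.
pose F m := T `&` \bigcap_(n in [set n | (m <= n)%N])
  (binary_digits @^-1` (~` u n) `&` `[0, 1[).
have mCu n : measurable (binary_digits @^-1` (~` u n) `&` `[0, 1[ : set R).
  apply: measurable_digits_clopen; have [ou cu] := (hu n).1.
  by split; [rewrite openC|rewrite closedC].
have mF m : measurable (F m).
  by apply: measurableI => //; apply: bigcap_measurableType => n _.
have F_nd : nondecreasing_seq F.
  move=> m p mp; apply/subsetPset; apply: setIS => t tF n /= pn.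
  by apply: tF => /=; exact: leq_trans mp pn.
have FT : \bigcup_m F m = T `&` `[0, 1[.
  apply/seteqP; split => [t [m _ [tT tm]]|t [tT tI]].
    by split => //; have [] := tm m (leqnn m).
  have [] := tT 0; rewrite ?rmorph0 ?addr0; first by move: tI; rewrite /= in_itv.
  by move=> m mP; exists m => //; split => // n /mP.
have muT0 : mu (T `&` `[0, 1[) = 0%E.
  have leF m : (2%:E * mu (F m) <= mu (T `&` `[0%R, 1%R[))%E.
    have := measure_avoid_half mT Tq (hu m); rewrite -/T -/mu => <-.
    rewrite lee_pmul2l//.
    apply: le_measure; rewrite ?inE.
    - exact: mF.
    - exact: measurableI mT (mCu m).
    by apply: setIS => t; apply => /=.
  have cF : mu (F m) @[m --> \oo] --> mu (T `&` `[0, 1[).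
    rewrite -FT; apply: nondecreasing_cvg_mu => //.
    by rewrite FT; exact: measurableI mT mI.
  have : (2%:E * mu (T `&` `[0%R, 1%R[) <= mu (T `&` `[0%R, 1%R[))%E.
    apply: (cvge_le _ (cvgeZl _ cF)) => //; exact: nearW.
  rewrite -(fineK muT_fin) -EFinM lee_fin => le2.
  have : 0 <= fine (mu (T `&` `[0, 1[)) by rewrite fine_ge0// measure_ge0.
  by move=> ?; congr EFin; lra.
(* An enumeration of the rationals; numbers that code no rational give 0. *)
pose q k : rat := odflt 0 (choice.unpickle k).
have mTI k := measurable_shift (ratr (q k)) (measurableI _ _ mT mI).
have : mu.-negligible (\bigcup_k
    ((fun x => x + ratr (q k)) @^-1` (T `&` `[0, 1[))).
  apply: negligible_bigcup => k; apply/negligibleP; first exact: mTI.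
  by rewrite -muT0; exact: lebesgue_measure_shift (measurableI _ _ mT mI).
apply: negligibleS => t tT.
exists (choice.pickle (- (Num.floor t)%:~R : rat)) => //.
rewrite preimage_setI Tq; split => //; rewrite /q choice.pickleK/= in_itv/=.
by rewrite rmorphN/= ratr_int subr_ge0 floor_le ltrBlDr addrC -intrD1 floorD1_gt.
Qed.

(** * Half-measure clopens avoiding a null set *)

Lemma ex_subset_card (T : finType) (A : {set T}) (m : nat) :
  (m <= #|A|)%N -> exists2 B : {set T}, B \subset A & #|B| = m.
Proof.
rewrite -bin_gt0 -cards_draws => /card_gt0P[B]; rewrite inE => /andP[BA /eqP].
by exists B.
Qed.

(** Some dyadic interval has all its digit sequences in [U], and its interior contains a rational.
    Hence [U] is nonempty, and it is met by a fixed countable set of reals. *)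
Lemma half_clopen_rat {R : realType} (U : set cantor_space) :
  half_clopens R U ->
  exists2 q : rat, 0 <= (ratr q : R) < 1 & U (binary_digits (ratr q : R)).
Proof.
move=> hU; have [n [S US]] := clopenP hU.1.
move: hU; rewrite US => /half_clopens_level cS.
have /card_gt0P[k kS] : (0 < #|S|)%N.
  by rewrite -double_gt0 cS expn_gt0.
have : k%:R / 2 ^+ n < k.+1%:R / 2 ^+ n :> R.
  by rewrite ltr_pM2r ?invr_gt0 ?exprn_gt0// ltr_nat.
move=> /rat_in_itvoo[q]; rewrite in_itv/= => /andP[kq qk].
have nkq : dyadic_itv n k (ratr q : R) by rewrite /dyadic_itv/= in_itv/= ltW.
have q01 := dyadic_itv01 (ltn_ord k) nkq.
exists q => //; rewrite /level/= (_ : prefix_ord _ n = k)//.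
by apply: val_inj; apply/dyadic_itvP.
Qed.

Lemma expr2_inv_lt {R : realType} (e : R) : 0 < e -> exists n, 2 ^- n < e.
Proof.
move=> e0; exists (Num.bound e^-1).
have ei0 : 0 <= e^-1 by rewrite invr_ge0 ltW.
rewrite invf_plt ?posrE ?exprn_gt0//.
apply: lt_le_trans (archi_boundP ei0) _.
by rewrite -natrX ler_nat ltnW// ltn_expl.
Qed.

(** Stated with [binary_value] so as to reach the sequences ending in ones, which [binary_digits]
    never produces. *)
Lemma ex_avoiding {R : realType} (N : set R) : null_ideal R N ->
  exists u : nat -> set cantor_space,
  [/\ forall n, half_clopens R (u n), infinite_set (range u) &
    forall x r, binary_value x r -> N r -> eventually_avoids u x].
Proof.
move=> N0; pose mu := @lebesgue_measure R.
(* With the rationals added, the open superset is dense, so that no half-measure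
   clopen occurs infinitely often in [u]. *)
have Q0 : mu.-negligible (range (@ratr R)).
  apply/negligibleP.
    rewrite (_ : range _ = \bigcup_(q : rat) [set ratr q]).
      exact: bigcupT_measurable_rat.
    by apply/seteqP; split => [_ [q _ <-]|_ [q _ ->]]; exists q.
  apply: countable_lebesgue_measure0.
  by apply: card_le_trans (card_image_le _ _) _; exact: countableP.
have [M [mM M0 NM]] := negligibleU N0 Q0.
have [||W [oW MW muWM]] := @lebesgue_regularity_outer R M 4^-1 mM.
- by rewrite M0 ltry.
- by rewrite invr_gt0.
have mW : measurable W by exact: open_measurable.
have muW : (mu W < 4^-1%:E)%E.
  have -> : mu W = (mu (W `\` M) + mu (W `&` M))%E by exact: measureDI.
  suff -> : mu (W `&` M) = 0%E by rewrite adde0.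
  apply/eqP; rewrite eq_le measure_ge0 andbT -M0.
  by apply: le_measure; rewrite ?inE//; exact: measurableI.
(* The intervals are closed since [r] may be the right endpoint of the interval given by a prefix of
   [x]. *)
pose P n := [set k : 'I_(2 ^ n) |
  `[< `[k%:R / 2 ^+ n, k.+1%:R / 2 ^+ n] `<=` W >]]%SET.
have cP n : (#|P n| * 4 <= 2 ^ n)%N.
  have : (@cantor_measure R (level (P n)) <= 4^-1%:E)%E.
    apply: le_trans (ltW muW).
    rewrite /cantor_measure /pushforward /mrestr.
    apply: le_measure; rewrite ?inE//.
      exact: measurable_digits_clopen (clopen_level _).
    rewrite digits_level => t [k /=]; rewrite inE => /asboolP kW tk.
    apply: kW; move: tk; rewrite /dyadic_itv/= !in_itv/= => /andP[-> /ltW].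
    by [].
  rewrite cantor_measure_level lee_fin ler_pdivrMr ?exprn_gt0//.
  by rewrite ler_pdivlMl// -natrX -natrM ler_nat mulnC.
(* The level is [n.+1] because [2 ^ 0] cannot be halved. At least three quarters of the indices lie
   outside [P n.+1], so half of them can be chosen there. *)
have /(_ _)/cid-/all_sig[S SP] n : exists S : {set 'I_(2 ^ n.+1)},
    S \subset ~: P n.+1 /\ (#|S|.*2 = 2 ^ n.+1)%N.
  have [|S SP cS] := @ex_subset_card _ (~: P n.+1) (2 ^ n)%N.
    by rewrite card_setC_pow; move: #|_| (cP n.+1) => c; rewrite expnS; lia.
  by exists S; split; rewrite // cS -mul2n -expnS.
pose u n := level (S n).
have hu n : half_clopens R (u n) by apply/half_clopens_level; exact: (SP n).2.
have u_avoids x r : binary_value x r -> M r -> eventually_avoids u x.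
  move=> xr /MW Wr.
  (* The closed interval of level [n.+1] containing [r] has length at most [2 ^- m < e], so it lies
     in [W] and its index is in [P n.+1], which [S n] avoids. *)
  have [e /= e0 eW] : nbhs r W by exact: open_nbhs_nbhs.
  have [m me] := expr2_inv_lt e0.
  exists m => n mn; rewrite /u /level/= => xS.
  have := fintype.subsetP (SP n).1 _ xS; rewrite !inE => /negP; apply.
  apply/asboolP => y; rewrite /= in_itv/= => /andP[ly yl]; apply: eW.
  have /andP[lr rl] := xr n.+1.
  apply: le_lt_trans me.
  have le_n : 2 ^- n.+1 <= 2 ^- m :> R.
    by rewrite lef_pV2 ?posrE ?exprn_gt0// ler_weXn2l ?ler1n// leqW.
  apply: le_trans le_n; move: yl rl ly lr; rewrite -natr1 mulrDl mul1r.
  set c : R := _%:R / _; set d : R := 2 ^- n.+1 => yl rl ly lr.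
  rewrite (_ : _ - _ = r - y :> R)// ler_norml.
  by apply/andP; split; lra.
exists u; split => //.
  (* With a finite range, [nat] is a finite union of fibres of [u]. Each value of [u] contains the
     digits of a rational, which is in [M], so its fibre is finite. *)
  move=> fin_u; apply: infinite_nat.
  rewrite (_ : setT = \bigcup_(U in range u) (u @^-1` [set U])).
    apply: bigcup_finite => // _ [n _ <-].
    have [q q01 unq] := half_clopen_rat (hu n).
    have [|m mP] := u_avoids _ _ (binary_value_digits q01).
      by apply: NM; right; exists q.
    apply: (@sub_finite_set _ _ `I_m) => // p /= up.
    by rewrite ltnNge; apply/negP => /mP; rewrite up.
  by apply/seteqP; split => // n _; exists (u n) => //; exists n.
by move=> x r xr Nr; apply: u_avoids xr _; apply: NM; left.
Qed.

(** * Countable and infinite sets *)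

Lemma countable_setU T (A B : set T) :
  countable A -> countable B -> countable (A `|` B).
Proof.
move=> cA cB; rewrite -bigcup2E; apply: bigcup_countable => //.
by move=> [|[|i]] _ /=.
Qed.

Lemma countable_image T U (A : set T) (f : T -> U) :
  countable A -> countable (f @` A).
Proof. exact/card_le_trans/card_image_le. Qed.

Lemma finite_nat_ub (A : set nat) : finite_set A ->
  exists m, forall n, (m <= n)%N -> ~ A n.
Proof.
move=> /finite_seqP[s ->]; exists (\max_(i <- s) i)%N.+1 => n mn /= ns.
move: mn; rewrite ltnNge => /negP; apply.
exact: (@leq_bigmax_seq _ s xpredT id n).
Qed.

Lemma infinite_image T U (A : set T) (f : T -> U) :
  {in A &, injective f} -> infinite_set A -> infinite_set (f @` A).
Proof. by move=> fI; rewrite (eq_finite_set (inj_card_eq fI)). Qed.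

(** * Generators of the Solecki ideal *)

(** Any set of half-measure clopens with [x] in its intersection is contained in this one, so these
    sets generate the ideal too. *)
Definition half_clopens_at (R : realType) (x : cantor_space) :
    set (set cantor_space) :=
  [set U | half_clopens R U /\ U x].

Lemma solecki_ideal_at (R : realType) x :
  solecki_ideal R (half_clopens_at R x).
Proof.
move=> I [_]; apply; split => [U []//|].
by exists x => U [].
Qed.

Lemma solecki_ideal_set1 (R : realType) U :
  half_clopens R U -> solecki_ideal R [set U].
Proof.
move=> hU I [_]; apply; split => [_ ->//|].
by have [q _ Uq] := half_clopen_rat hU; exists (binary_digits (ratr q : R)) => _ ->.
Qed.

(** The subsets of [half_clopens R] with such a cover form an ideal containing the generators. *)
Lemma solecki_ideal_cover (R : realType) B : solecki_ideal R B ->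
  exists2 X, finite_set X & B `<=` \bigcup_(x in X) half_clopens_at R x.
Proof.
move=> SB.
suff [] : (B `<=` half_clopens R /\
  exists2 X, finite_set X & B `<=` \bigcup_(x in X) half_clopens_at R x) by [].
apply: (SB [set C | C `<=` half_clopens R /\ exists2 X, finite_set X &
  C `<=` \bigcup_(x in X) half_clopens_at R x]); split.
  split.
  - by move=> A [].
  - by split=> //; exists set0.
  - move=> A C AC [CR [X fX CX]]; split; first exact: subset_trans CR.
    by exists X => //; exact: subset_trans CX.
  - move=> A C [AR [X fX AX]] [CR [Y fY CY]]; split; first by rewrite subUset.
    exists (X `|` Y); first by rewrite finite_setU.
    by rewrite bigcup_setU; exact: setUSS.
move=> A [AR [x xA]]; split => //; exists [set x]; first exact: finite_set1.
by rewrite bigcup_set1 => U AU; split; [exact: AR|exact: xA].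
Qed.

(** * Comparison of the two cardinals *)

Lemma non_star_omega_le_cov_omega (R : realType) G :
  cov_omega_families (null_ideal R) G ->
  exists2 F, non_star_omega_families (half_clopens R) (solecki_ideal R) F &
    F #<= G.
Proof.
move=> [GN Gcov].
have /choice[u uP] : forall N : set R, exists u : nat -> set cantor_space,
    null_ideal R N -> [/\ forall n, half_clopens R (u n), infinite_set (range u) &
    forall x r, binary_value x r -> N r -> eventually_avoids u x].
  move=> N; have [/ex_avoiding[u uP]|nN] := pselect (null_ideal R N).
    by exists u.
  by exists (fun=> set0) => /nN.
exists ((fun N => range (u N)) @` G); last exact: card_image_le.
split.
  move=> _ [N GNN <-]; have [hu iu _] := uP N (GN _ GNN).
  split; first by move=> _ [n _ <-].
  apply: eq_card_nat => //.
  exact: countable_image.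
move=> Bs [SBs cBs].
have /choice[X XP] : forall B, exists X, Bs B -> finite_set X /\
    B `<=` \bigcup_(x in X) half_clopens_at R x.
  move=> B; have [/SBs/solecki_ideal_cover[X fX BX]|nB] := pselect (Bs B).
    by exists X.
  by exists set0.
have /choice[phi phiP] := @ex_binary_value R.
(* [V] holds a value of each point used to cover the members of [Bs]; the natural numbers make it
   infinite. *)
pose V : set R := phi @` (\bigcup_(B in Bs) X B) `|` range (fun n => n%:R).
have [|N GNN VN] := Gcov V.
  split => //; apply: eq_card_nat.
    rewrite /V; apply: countable_setU.
      apply: countable_image.
      apply: bigcup_countable; first by move: cBs; rewrite card_eq_le => /andP[].
      by move=> B /XP[fX _]; exact: finite_set_countable.
    exact: countable_image.
  apply: (@sub_infinite_set _ (range (fun n => n%:R : R))).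
    by move=> r; right.
  apply: infinite_image infinite_nat.
  by move=> m n _ _ /eqP; rewrite eqr_nat => /eqP.
have [_ _ uN] := uP N (GN _ GNN).
exists (range (u N)) => [|B BsB]; first by exists N.
have [fX BX] := XP _ BsB.
(* Each member of [B] contains one of the finitely many points of [X B], and each such point lies in
   finitely many [u N n]. *)
apply: (@sub_finite_set _ _ (\bigcup_(x in X B) (range (u N) `&` [set U | U x]))).
  by move=> U [uU /BX[x Xx [_ Ux]]]; exists x.
apply: bigcup_finite => // x Xx.
have [|m mP] := uN x (phi x) (phiP x).
  by apply: VN; left; exists x => //; exists B.
apply: (@sub_finite_set _ _ (u N @` `I_m)); last exact: finite_image.
move=> _ [[n _ <-] /= unx]; exists n => //=.
by rewrite ltnNge; apply/negP => /mP.
Qed.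

Lemma cov_omega_le_non_star_omega (R : realType) F :
  non_star_omega_families (half_clopens R) (solecki_ideal R) F ->
  exists2 G, cov_omega_families (null_ideal R) G & G #<= F.
Proof.
move=> [FO Fsel].
have /choice[u uP] : forall A, exists u : nat -> set cantor_space,
    F A -> injective u /\ forall n, A (u n).
  move=> A; have [FA|nFA] := pselect (F A); last by exists (fun=> set0) => /nFA.
  have [_] := FO _ FA; rewrite card_eq_le => /andP[_ /pcard_leP[u]].
  by exists u => _; split => [m n /inj|n]; [apply; rewrite inE|exact: funS].
have hu A : F A -> forall n, half_clopens R (u A n).
  by move=> FA n; apply: (FO _ FA).1; exact: (uP _ FA).2.
exists ((fun A => avoiding_reals (u A)) @` F); last exact: card_image_le.
split; first by move=> _ [A FA <-]; exact/null_avoiding_reals/hu.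
move=> B [_ cB].
(* Only infinitely many half-measure clopens are wanted here, so the empty null set will do. *)
have [w [hw iw _]] := @ex_avoiding R set0 (negligible_set0 _).
(* Translates are included because [avoiding_reals] constrains all of them. *)
pose Y : set cantor_space :=
  \bigcup_(b in B) range (fun q : rat => binary_digits (b + ratr q)).
(* The singletons only serve to make the family infinite. *)
have [|A FA AP] := Fsel (half_clopens_at R @` Y `|` set1 @` range w).
  split.
    move=> _ [[x _ <-]|[_ [n _ <-] <-]]; first exact: solecki_ideal_at.
    exact: solecki_ideal_set1.
  apply: eq_card_nat.
    apply: countable_setU.
      apply: countable_image.
      apply: bigcup_countable; first by move: cB; rewrite card_eq_le => /andP[].
      by move=> b _; apply: countable_image; exact: countableP.
    apply: countable_image.
    exact: countable_image.
  apply: (@sub_infinite_set _ (set1 @` range w)); first by move=> C; right.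
  apply: infinite_image iw.
  by move=> U V _ _ /seteqP[/(_ U erefl)].
exists (avoiding_reals (u A)); first by exists A.
(* As [u A] is injective into [A], finitely many members of [A] containing [x] account for finitely
   many indices. *)
move=> b Bb q _; apply: finite_nat_ub.
have [uinj uA] := uP _ FA.
set x := binary_digits _.
apply: (@sub_finite_set _ _ (u A @^-1` (A `&` half_clopens_at R x))).
  by move=> n unx; split; [exact: uA|split; [exact: hu|]].
apply: finite_preimage; first by move=> m n _ _; exact: uinj.
by apply: AP; left; exists x => //; exists b => //; exists q.
Qed.

Theorem proposition3p32 (R : realType) :
  exists F G,
    [/\ least_card
          (non_star_omega_families (half_clopens R) (solecki_ideal R)) F,
        least_card (cov_omega_families (null_ideal R)) G &
        F #= G].
Proof.
have [G0 covG0] : cov_omega_families (null_ideal R) !=set0.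
  exists (null_ideal R); split => // B [_]; rewrite card_eq_le => /andP[cB _].
  exists B => //.
  apply/negligibleP; first exact: countable_measurable.
  exact: countable_lebesgue_measure0.
have [F0 nsF0 _] := non_star_omega_le_cov_omega covG0.
have [F [nsF leF]] := ex_least_card (ex_intro _ _ nsF0).
have [G covG GF] := cov_omega_le_non_star_omega nsF.
(* Leastness of [F] makes it inject into every covering family; since [G] injects into [F], [G] is
   least too and equinumerous with [F]. *)
have FcovG' G' : cov_omega_families (null_ideal R) G' -> F #<= G'.
  move=> /non_star_omega_le_cov_omega[F' nsF' F'G'].
  exact: card_le_trans (leF _ nsF') F'G'.
exists F, G; split => //.
  by split => // G' /FcovG'; exact: card_le_trans.
by rewrite card_eq_le FcovG'.
Qed.
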